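(* Let $(N,M,V,G)$ be a problem instance with $n=|N|>\Delta(G)$. Then there exists an $\alpha$-approximate MMS allocation with $\alpha>1/3$. Specifically, there exists an $\alpha$-approximate MMS allocation with $$\alpha=\begin{cases}1 & \text{if } n\le 2,\\ \frac{2}{3} & \text{if } n=3,\\ \frac{n}{2n-1} & \text{if } n\ge 4 \text{ and } \chi(G)=2,\\ \frac{\chi(G)}{3\chi(G)-3} & \text{if } n\ge 4 \text{ and } \chi(G)\ge 3.\end{cases}$$
   Context: A problem instance is a quadruple $(N,M,V,G)$, where $N$ is a finite set of $n$ agents, $M$ is a finite set of $m$ items, $V$ is a family of additive valuation functions $v_i:2^M\to\mathbb{R}_{\ge 0}$, $i\in N$ (so $v_i(S)=\sum_{j\in S}v_i(\{j\})$), and $G=(M,E)$ is an undirected (simple) conflict graph on the items. An allocation is an ordered partition $A=\langle A_i\rangle_{i\in N}$ of $M$ into $|N|$ (possibly empty) bundles, bundle $A_i$ going to agent $i$; it is feasible if every bundle is an independent set of $G$. The maximin share of agent $i$ is $\mu_i=\max_{A}\min_{k\in N}v_i(A_k)$, where the maximum is over all feasible allocations $A$. A feasible allocation $A$ is $\alpha$-approximate MMS if $v_i(A_i)\ge\alpha\mu_i$ for all $i\in N$. $\Delta(G)$ is the maximum degree of $G$ and $\chi(G)$ its chromatic number. *)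

(* Defs.v *)
From mathcomp Require Import all_boot all_order all_algebra.

Set Implicit Arguments.
Unset Strict Implicit.
Unset Printing Implicit Defensive.

Import Order.TTheory GRing.Theory Num.Theory.

Record sgraph (M : finType) := SGraph {
  edge :> rel M;
  edge_sym : symmetric edge;
  edge_irr : irreflexive edge
}.

Section Graphs.
Variables (M : finType) (G : sgraph M).

Definition degree (x : M) : nat := #|[set y | G x y]|.

Definition max_degree : nat := \max_(x : M) degree x.

Definition independent (S : {set M}) : bool :=
  [forall x in S, forall y in S, ~~ G x y].

Definition colorable (k : nat) : bool :=
  [exists c : {ffun M -> 'I_k},
    [forall x, forall y, G x y ==> (c x != c y)]].

Lemma exists_colorable : exists k, colorable k.
Proof.
exists #|M|; apply/existsP; exists [ffun x => enum_rank x].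
apply/forallP => x; apply/forallP => y; apply/implyP => Gxy.
rewrite !ffunE; apply/eqP => /enum_rank_inj xy.
by rewrite xy edge_irr in Gxy.
Qed.

Definition chromatic_number : nat := ex_minn exists_colorable.

End Graphs.

Local Open Scope ring_scope.

Definition additive_valuation (R : realFieldType) (M : finType)
    (v : {set M} -> R) : Prop :=
  (forall S, 0 <= v S) /\ (forall S, v S = \sum_(j in S) v [set j]).

Section Allocations.
Variables (N M : finType).

Definition allocation (A : {ffun N -> {set M}}) : bool :=
  [forall i, forall j, (i != j) ==> [disjoint A i & A j]]
  && (\bigcup_(i : N) A i == [set: M]).

Definition feasible (G : sgraph M) (A : {ffun N -> {set M}}) : bool :=
  allocation A && [forall i, independent G (A i)].

Variable R : realFieldType.

(* The default [v i (A i)] is itself one of the values being compared, so it does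
   not affect the inner minimum. The default 0 does not affect the outer maximum
   of nonnegative values, as soon as some allocation is feasible (which is the
   case when #|N| exceeds the maximum degree of G); otherwise the share is 0. *)
Definition maximin_share (G : sgraph M) (v : N -> {set M} -> R) (i : N) : R :=
  \big[Num.max/0]_(A : {ffun N -> {set M}} | feasible G A)
    \big[Num.min/v i (A i)]_(k : N) v i (A k).

Definition approx_mms (G : sgraph M) (v : N -> {set M} -> R) (alpha : R)
    (A : {ffun N -> {set M}}) : Prop :=
  feasible G A /\ forall i, alpha * maximin_share G v i <= v i (A i).

End Allocations.

(* Main.v *)
(* Since |N| > Delta(G), an item that is left over always fits into some bundle, so
   disjoint independent bundles worth alpha * mu_i to each agent i suffice. If an
   agent i values a single item at least alpha * mu_i, it gets that item; each other
   agent loses at most one bundle of its maximin partition. When n' agents are left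
   and all items are small, use lone-divider rounds with envy-free matchings: an
   unmatched agent has lost less than alpha * mu_i per departed agent, and after the
   first round a divider has to form at most n' - 1 bundles, which it does by bag
   filling, at most 2 * alpha * mu_i each, inside c given independent sets that cover
   its remaining bundles. This works as soon as alpha * (2 * n' - 3 + c) <= n', where
   the independent sets are either these n' bundles (c = n') or colour classes
   (c = chi(G)). Two agents cut and choose. For three agents the only obstacle is that
   two of them want the same bundle P of the divider; as Delta(G) <= 2, they can
   share P together with another bundle. *)

Require Import Defs.
From mathcomp Require Import all_boot all_order all_algebra.
From mathcomp Require Import perm zify lra.
Import Order.TTheory GRing.Theory Num.Theory.
Local Open Scope ring_scope.

Set Implicit Arguments.
Unset Strict Implicit.
Unset Printing Implicit Defensive.

(** * Matchings: Hall's theorem and its envy-free variant *)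

(** Hall's theorem, by induction on [#|X|]: either some nonempty proper subset is tight, and it and
    the rest are matched separately, or any single edge can be removed with its ends. The point [k0]
    only makes [f] total. *)
Lemma hall_matching (N K : finType) (k0 : K) (e : N -> {set K}) (X : {set N}) :
  (forall Z : {set N}, Z \subset X -> (#|Z| <= #|\bigcup_(x in Z) e x|)%N) ->
  exists2 f : N -> K, {in X &, injective f} & {in X, forall x, f x \in e x}.
Proof.
have [n] := ubnP #|X|; elim: n e X => // n IHn e X leXn hall.
have [->|/set0Pn[x Xx]] := eqVneq X set0.
  by exists (fun=> k0) => x; rewrite ?inE // => y; rewrite inE.
have [/existsP[Z /and4P[sZX Z0 ZX /eqP tight]]|/existsPn loose] :=
    boolP [exists Z : {set N}, [&& Z \subset X, Z != set0, Z != X &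
                                 #|\bigcup_(x in Z) e x| == #|Z|]].
- have ltZX : (#|Z| < #|X|)%N by apply: proper_card; rewrite properEneq ZX.
  have cardXZ := cardsID Z X; rewrite (setIidPr sZX) in cardXZ.
  have Z_gt0 : (0 < #|Z|)%N by rewrite card_gt0.
  have [||f1 inj1 f1e] := IHn e Z.
    + by lia.
    + by move=> W sWZ; apply: hall; apply: subset_trans sZX.
  pose NZ := \bigcup_(x in Z) e x.
  have [||f2 inj2 f2e] := IHn (fun x => e x :\: NZ) (X :\: Z).
    + by lia.
    + move=> W; rewrite subsetD => /andP[sWX dWZ].
      (* Hall's condition for [W :|: Z] and tightness of [Z] leave at least [#|W|] neighbours of [W]
         outside [NZ]. *)
      have -> : \bigcup_(y in W) (e y :\: NZ) = \bigcup_(y in W :|: Z) e y :\: NZ.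
        apply/setP=> k; rewrite inE; apply/bigcupP/andP.
          move=> [y Wy]; rewrite inE => /andP[kNZ key]; split=> //.
          by apply/bigcupP; exists y; rewrite // inE Wy.
        move=> [kNZ /bigcupP[y]]; rewrite inE => /orP[Wy|Zy] key.
          by exists y; rewrite // inE kNZ.
        by case/negP: kNZ; apply/bigcupP; exists y.
      have /hall : W :|: Z \subset X by rewrite subUset sWX.
      rewrite cardsU (disjoint_setI0 dWZ) cards0 subn0 cardsD => leWZ.
      have : (#|\bigcup_(y in W :|: Z) e y :&: NZ| <= #|NZ|)%N.
        exact: subset_leq_card (subsetIr _ _).
      rewrite /NZ tight; lia.
  exists (fun y => if y \in Z then f1 y else f2 y).
    have cross y z : y \in Z -> z \in X :\: Z -> f1 y = f2 z -> y = z.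
      move=> Zy Xz fyz; have := f2e z Xz; rewrite inE -fyz => /andP[/negP[]].
      by apply/bigcupP; exists y => //; apply: f1e.
    move=> y z Xy Xz; case: ifPn => Zy; case: ifPn => Zz.
    + exact: inj1.
    + by apply: cross; rewrite // inE Zz.
    + by move=> /esym fzy; apply/esym; move: fzy; apply: cross; rewrite // inE Zy.
    + by apply: inj2; rewrite inE ?Zy ?Zz.
  move=> y Xy; case: ifPn => Zy; first exact: f1e.
  have : y \in X :\: Z by rewrite inE Zy.
  by move/f2e; rewrite inE => /andP[].
(* Without tight sets, every nonempty subset of [X :\ x] has a neighbour to spare, so an arbitrary
   [k] in [e x] may be deleted. *)
- have /card_gt0P[k kex] : (0 < #|e x|)%N.
    by have := hall [set x]; rewrite big_set1 cards1; apply; rewrite sub1set.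
  have cardX := cardsD1 x X; rewrite Xx in cardX.
  have [||f injf fe] := IHn (fun y => e y :\ k) (X :\ x).
    + by lia.
    + move=> W sWX; have [->|W0] := eqVneq W set0; first by rewrite cards0.
      have sWX' : W \subset X := subset_trans sWX (subD1set _ _).
      have xW : x \notin W.
        by apply/negP => /(subsetP sWX); rewrite !inE eqxx.
      have := loose W; rewrite sWX' W0 /=.
      have -> /= : W != X by apply: contraNneq xW => ->.
      have := hall W sWX'.
      have -> : \bigcup_(y in W) (e y :\ k) = (\bigcup_(y in W) e y) :\ k.
        apply/setP=> l; rewrite !inE; apply/bigcupP/andP.
          move=> [y Wy]; rewrite !inE => /andP[lk ley]; split=> //.
          by apply/bigcupP; exists y.
        by move=> [lk /bigcupP[y Wy ley]]; exists y; rewrite // !inE lk.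
      have := cardsD1 k (\bigcup_(y in W) e y).
      by case: (k \in _) => /=; lia.
  exists (fun y => if y == x then k else f y).
    have cross z : z \in X -> z != x -> k = f z -> False.
      move=> Xz zx kf; have : z \in X :\ x by rewrite !inE zx.
      by move/fe; rewrite !inE -kf eqxx.
    move=> y z Xy Xz; case: (eqVneq y x) => [->|yx]; case: (eqVneq z x) => [->|zx] //.
    + by move/cross => []; rewrite // eq_sym.
    + by move/esym/cross => [].
    + by apply: injf; rewrite !inE ?yx ?zx.
  move=> y Xy; case: (eqVneq y x) => [->//|yx].
  have : y \in X :\ x by rewrite !inE yx.
  by move/fe; rewrite !inE => /andP[].
Qed.

(* The unmatched vertices [X :\: Y] see none of the matched bundles. *)
Lemma envy_free_matching (N K : finType) (k0 : K) (e : N -> {set K})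
    (X : {set N}) :
  X != set0 -> (#|X| <= #|\bigcup_(x in X) e x|)%N ->
  exists Y : {set N}, exists f : N -> K,
    [/\ Y \subset X, Y != set0, {in Y &, injective f},
        {in Y, forall y, f y \in e y} &
        {in X :\: Y & Y, forall z y, f y \notin e z}].
Proof.
have [n] := ubnP #|X|; elim: n e X => // n IHn e X leXn X0 leX.
have [/existsP[Z /andP[sZX ltZ]]|/existsPn hall] :=
    boolP [exists Z : {set N}, (Z \subset X) && (#|\bigcup_(x in Z) e x| < #|Z|)%N].
(* [Z] violates Hall's condition. Dropping [Z] and [NZ] loses fewer neighbours than vertices of [X],
   so the count survives, and no vertex of [Z] sees anything outside [NZ]. *)
- pose NZ := \bigcup_(x in Z) e x.
  have cardXZ := cardsID Z X; rewrite (setIidPr sZX) in cardXZ.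
  have ltZX : (#|Z| < #|X|)%N.
    apply: proper_card; rewrite properEneq sZX andbT.
    by apply: contraTneq ltZ => ->; rewrite -leqNgt.
  have [||| Y [f [sYX Y0 injf fe ef]]] := IHn (fun x => e x :\: NZ) (X :\: Z).
  + by lia.
  + by rewrite -card_gt0; lia.
  + have sub : \bigcup_(x in X) e x :\: NZ \subset \bigcup_(x in X :\: Z) (e x :\: NZ).
      apply/subsetP => k; rewrite inE => /andP[kNZ /bigcupP[y Xy key]].
      apply/bigcupP; exists y; rewrite !inE ?kNZ ?Xy // andbT.
      by apply: contra kNZ => Zy; apply/bigcupP; exists y.
    have := subset_leq_card sub; rewrite cardsD.
    have := subset_leq_card (subsetIr (\bigcup_(x in X) e x) NZ).
    rewrite -/NZ in ltZ; lia.
  exists Y, f; split=> //.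
  + exact: subset_trans sYX (subsetDl _ _).
  + by move=> y /fe; rewrite inE => /andP[].
  + move=> z y; rewrite inE => /andP[zY Xz] Yy.
    have := fe y Yy; rewrite inE => /andP[fyNZ _].
    have [Zz|Zz] := boolP (z \in Z).
      by apply: contra fyNZ => fyz; apply/bigcupP; exists z.
    have := ef z y; rewrite !inE Zz zY Xz Yy fyNZ /=.
    by apply.
- have [|f injf fe] := hall_matching k0 (e := e) (X := X).
    by move=> Z sZX; have := hall Z; rewrite sZX -leqNgt.
  by exists X, f; split=> // z y; rewrite setDv inE.
Qed.

Lemma exists_injection (N K : finType) (k0 : K) (X : {set N}) (J : {set K}) :
  (#|X| <= #|J|)%N ->
  exists2 f : N -> K, {in X &, injective f} & {in X, forall x, f x \in J}.
Proof.
move=> leXJ; apply: (hall_matching k0 (e := fun=> J)) => Z sZX.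
have [->|/set0Pn[z Zz]] := eqVneq Z set0; first by rewrite cards0.
apply: leq_trans (subset_leq_card sZX) (leq_trans leXJ _).
by apply: subset_leq_card; apply: (bigcup_max z).
Qed.

(** * Additive valuations on sets of items *)

Section Valuation.
Variables (R : realFieldType) (M : finType) (v : {set M} -> R).
Hypothesis hv : additive_valuation v.

Implicit Types S T : {set M}.

Lemma val_ge0 S : 0 <= v S. Proof. by case: hv. Qed.

Lemma val_sum S : v S = \sum_(x in S) v [set x]. Proof. by case: hv. Qed.

Lemma val0 : v set0 = 0. Proof. by rewrite val_sum big_set0. Qed.

Lemma valID S T : v S = v (S :&: T) + v (S :\: T).
Proof. by rewrite val_sum (big_setID T) -!val_sum. Qed.

Lemma valS S T : S \subset T -> v S <= v T.
Proof. by move=> sST; rewrite (valID T S) (setIidPr sST) lerDl val_ge0. Qed.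

Lemma valD S T : v S - v T <= v (S :\: T).
Proof. by have := valS (subsetIr S T); rewrite (valID S T); lra. Qed.

Lemma valU S T : [disjoint S & T] -> v (S :|: T) = v S + v T.
Proof.
move=> dST; rewrite (valID _ S) setUK; congr (_ + v _).
by rewrite setDUl setDv set0U; apply/setDidPl; rewrite disjoint_sym.
Qed.

Lemma valU_le S T : v (S :|: T) <= v S + v T.
Proof.
by rewrite (valID _ S) setUK lerD2l setDUl setDv set0U valS ?subsetDl.
Qed.

Lemma val_bigcup_le (K : finType) (J : {set K}) (C : K -> {set M}) :
  v (\bigcup_(k in J) C k) <= \sum_(k in J) v (C k).
Proof.
elim/big_rec2: _ => [|k s S _ le_s]; first by rewrite val0.
by apply: le_trans (valU_le _ _) _; rewrite lerD2l.
Qed.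

Lemma val_bigcup (K : finType) (J : {set K}) (C : K -> {set M}) :
  (forall j k, j != k -> [disjoint C j & C k]) ->
  v (\bigcup_(k in J) C k) = \sum_(k in J) v (C k).
Proof.
move=> dC; have [n] := ubnP #|J|; elim: n J => // n IHn J ltJn.
have [->|/set0Pn[k Jk]] := eqVneq J set0; first by rewrite !big_set0 val0.
rewrite !(big_setD1 k Jk) /= valU ?IHn //.
  by move: ltJn; rewrite (cardsD1 k) Jk.
by apply/bigcup_disjoint => j; rewrite !inE => /andP[jk _]; rewrite dC // eq_sym.
Qed.

End Valuation.

(** * Elementary facts on disjoint and independent sets *)

Lemma disjoints0r (T : finType) (S : {set T}) : [disjoint S & set0].
Proof. by rewrite disjoint_sym disjoints_subset sub0set. Qed.

Lemma independentP (M : finType) (G : sgraph M) (S : {set M}) :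
  reflect {in S &, forall x y, ~~ G x y} (independent G S).
Proof.
apply: (iffP forall_inP) => [ind x y Sx Sy|ind x Sx].
  by have /forall_inP := ind x Sx; apply.
by apply/forall_inP => y; apply: ind.
Qed.

Lemma independentS (M : finType) (G : sgraph M) (S T : {set M}) :
  S \subset T -> independent G T -> independent G S.
Proof.
move=> /subsetP sST /independentP indT; apply/independentP => x y Sx Sy.
by apply: indT; apply: sST.
Qed.

Lemma independent_le1 (M : finType) (G : sgraph M) (S : {set M}) :
  (#|S| <= 1)%N -> independent G S.
Proof.
move=> /card_le1_eqP S1; apply/independentP => x y Sx Sy.
by rewrite (S1 _ _ Sx Sy) edge_irr.
Qed.

(** * Partial allocations and their composition *)

Section Serves.
Variables (R : realFieldType) (N M : finType) (G : sgraph M).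
Implicit Types (X Y : {set N}) (U S W : {set M}) (A B : N -> {set M}).
Implicit Types (v : N -> {set M} -> R) (t : N -> R).

(* A partial allocation: [U] is the set of items that are already taken, and items
   may be left over. With constant families [v] and [t], it says that a single
   valuation sees [#|X|] disjoint feasible bundles. *)
Definition serves v t X U A : Prop :=
  {in X, forall i, [/\ independent G (A i), [disjoint A i & U] & t i <= v i (A i)]}
  /\ {in X &, forall i j, i != j -> [disjoint A i & A j]}.

Lemma serves0 v t U A : serves v t set0 U A.
Proof. by split=> i; rewrite inE. Qed.

(** Rounds compose: what [Y] receives counts as taken when the others are served. *)
Lemma serves_union v t X Y U A B :
    serves v t Y U A -> serves v t (X :\: Y) (U :|: \bigcup_(y in Y) A y) B ->
  serves v t X U (fun i => if i \in Y then A i else B i).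
Proof.
move=> [sA dA] [sB dB].
have cross y i : y \in Y -> i \in X -> i \notin Y -> [disjoint A y & B i].
  move=> Yy Xi Yi; have [|_ + _] := sB i; first by rewrite inE Yi.
  rewrite disjoint_sym; apply: disjointWl.
  by rewrite subsetU // (bigcup_max y) ?orbT.
split=> [i Xi|i j Xi Xj ij].
  case: ifPn => Yi; first exact: sA.
  have [|? + ?] := sB i; first by rewrite inE Yi.
  by rewrite disjoint_sym => dU; split=> //; rewrite disjoint_sym (disjointWl (subsetUl _ _) dU).
case: ifPn => Yi; case: ifPn => Yj; [exact: dA|exact: cross| |].
  by rewrite disjoint_sym; apply: cross.
by apply: dB; rewrite // inE ?Yi ?Yj.
Qed.

Lemma serves_add1 v t X U x S B :
    x \in X -> independent G S -> [disjoint S & U] -> t x <= v x S ->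
    serves v t (X :\ x) (U :|: S) B ->
  serves v t X U (fun i => if i \in [set x] then S else B i).
Proof.
move=> Xx indS dS tS sB; apply: serves_union; last by rewrite big_set1.
split=> [i /set1P->|i j /set1P-> /set1P->]; first by split.
by rewrite eqxx.
Qed.

(** * Bag filling and the lone-divider procedure *)

(** Each bundle is a minimal part of one [C k] worth [t]; it drops below [t] without any one of its
    items, so it costs at most [2 * t]. Before the last bundle a mass of [#|J| * t] remains, and by
    averaging some [C k] can supply it; hence the [- 2]. *)
Lemma bag_filling (v : {set M} -> R) (t : R) (K : finType) (C : K -> {set M})
    (J : {set K}) X U W :
    additive_valuation v -> 0 < t ->
    {in ~: U, forall g, v [set g] <= t} ->
    J != set0 -> {in J, forall k, independent G (C k)} ->
    W \subset \bigcup_(k in J) C k ->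
    t * (2 * #|X|%:R - 2 + #|J|%:R) <= v (W :\: U) ->
  exists A, serves (fun=> v) (fun=> t) X U A.
Proof.
move=> hv t0 small J0 indC sW.
have [n] := ubnP #|X|; elim: n X U small => // n IHn X U small ltXn leW.
have [->|/set0Pn[x Xx]] := eqVneq X set0.
  by exists (fun=> set0); apply: serves0.
have cardX := cardsD1 x X; rewrite Xx in cardX.
have cardXR : #|X|%:R = 1 + #|X :\ x|%:R :> R by rewrite cardX natrD.
have [/existsP[k /andP[Jk tk]]|/existsPn none] :=
    boolP [exists k, (k \in J) && (t <= v (C k :\: U))]; last first.
  have : v (W :\: U) <= v (\bigcup_(k in J) (C k :\: U)).
    apply: (valS hv); apply/subsetP => g; rewrite inE => /andP[gU].
    move=> /(subsetP sW)/bigcupP[k Jk gk].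
    by apply/bigcupP; exists k; rewrite // inE gU.
  have : \sum_(k in J) v (C k :\: U) < \sum_(k in J) t.
    apply: ltr_sum => [|k Jk].
      by case/set0Pn: J0 => k Jk; apply/hasP; exists k; rewrite ?mem_index_enum.
    by have := none k; rewrite Jk -ltNge.
  have := val_bigcup_le hv J (fun k => C k :\: U).
  have X_ge0 := ler0n R #|X :\ x|.
  by rewrite sumr_const -mulr_natr cardXR in leW *; nra.
have [S /minsetP[tS minS] sS] :=
  @minset_exists _ [pred S : {set M} | t <= v S] _ tk.
move: sS; rewrite subsetD => /andP[sSC dSU].
have vS : v S <= 2 * t.
  have [S0|/set0Pn[g Sg]] := eqVneq S set0.
    by rewrite S0 (val0 hv); lra.
  have := valU_le hv [set g] (S :\ g); rewrite setD1K //.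
  have : v [set g] <= t.
    by apply: small; rewrite inE (disjointFr dSU).
  have : v (S :\ g) < t.
    rewrite ltNge; apply/negP => tSg.
    have /setP/(_ g) := minS _ tSg (subD1set _ _).
    by rewrite !inE eqxx Sg.
  lra.
have [|||B sB] := IHn (X :\ x) (U :|: S).
- by move=> g; rewrite !inE negb_or => /andP[gU _]; apply: small; rewrite inE.
- by move: ltXn; rewrite cardX.
- by have := valD hv (W :\: U) S; rewrite setDDl cardXR in leW *; nra.
exists (fun i => if i \in [set x] then S else B i).
by apply: serves_add1 => //; apply: independentS sSC (indC k Jk).
Qed.

(** The divider [i] accepts every bundle of [D], so the acceptance graph has enough neighbours for a
    nonempty envy-free matching. An unmatched agent finds each departing bundle below its
    threshold. *)
Lemma lone_divider_step v t X U i (D : N -> {set M}) :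
    (forall j, additive_valuation (v j)) -> i \in X ->
    serves (fun=> v i) (fun=> t i) X U D ->
  exists Y A, [/\ Y \subset X, Y != set0, serves v t Y U A &
    {in X :\: Y, forall z, v z (\bigcup_(y in Y) A y) <= #|Y|%:R * t z}].
Proof.
move=> hv Xi [sD dD].
pose e x := [set j in X | t x <= v x (D j)].
have X0 : X != set0 by apply/set0Pn; exists i.
have [|Y [f [sYX Y0 injf fe ef]]] := envy_free_matching i (e := e) X0.
  apply/subset_leq_card/(bigcup_max i) => //.
  by apply/subsetP => j Xj; rewrite inE Xj; have [] := sD j Xj.
have fX y : y \in Y -> f y \in X by move/fe; rewrite inE => /andP[].
exists Y, (D \o f); split=> //.
  split=> [y Yy|y z Yy Yz yz] /=.
    have [indD dU _] := sD _ (fX y Yy); split=> //.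
    by have := fe y Yy; rewrite inE => /andP[].
  by apply: dD; rewrite ?fX //; apply: contra_neq yz => /injf; apply.
move=> z XYz; apply: le_trans (val_bigcup_le (hv z) _ _) _.
rewrite mulr_natl -sumr_const; apply: ler_sum => y Yy.
have := ef z y XYz Yy; rewrite inE fX //= -ltNge.
exact: ltW.
Qed.

(* An unmatched agent values each bundle that leaves below its threshold [t], so
   [#|X| - #|Y|] bundles cost it at most [(#|X| - #|Y|) * t]. *)
Lemma lone_divider v t X U :
    (forall i, additive_valuation (v i)) ->
    {in X, forall i, exists D, serves (fun=> v i) (fun=> t i) X U D} ->
    {in X, forall i Y W, Y \proper X -> v i W <= (#|X|%:R - #|Y|%:R) * t i ->
      exists D, serves (fun=> v i) (fun=> t i) Y (U :|: W) D} ->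
  exists A, serves v t X U A.
Proof.
move=> hv; have [n] := ubnP #|X|; elim: n X U => // n IHn X U ltXn divX divY.
have [->|/set0Pn[i Xi]] := eqVneq X set0.
  by exists (fun=> set0); apply: serves0.
have [D sD] := divX i Xi.
have [Y [A [sYX Y0 sA leA]]] := lone_divider_step hv Xi sD.
have cardXY := cardsID Y X; rewrite (setIidPr sYX) in cardXY.
have cardXYR : #|X|%:R = #|Y|%:R + #|X :\: Y|%:R :> R.
  by rewrite -natrD cardXY.
have Y_gt0 : (0 < #|Y|)%N by rewrite card_gt0.
have XYproper : X :\: Y \proper X.
  by rewrite properEcard subsetDl; lia.
have [||| B sB] := IHn (X :\: Y) (U :|: \bigcup_(y in Y) A y).
- by lia.
(* [divY] yields both hypotheses for the remaining agents: first with the items of this round as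
   [W], then with these items merged into any later loss. The bounds telescope. *)
- move=> z XYz; apply: divY => //; first by move: XYz; rewrite inE => /andP[].
  by apply: le_trans (leA z XYz) _; rewrite cardXYR; lra.
- move=> z XYz Z W ZXY leW; rewrite -setUA; apply: divY.
  + by move: XYz; rewrite inE => /andP[].
  + exact: proper_trans ZXY XYproper.
  + have := valU_le (hv z) (\bigcup_(y in Y) A y) W.
    by have := leA z XYz; rewrite cardXYR; lra.
by eexists; apply: serves_union sA sB.
Qed.

(** * Maximin partitions: small items, and removal of valuable single items *)

(** [B] is a partition that one agent has in mind; its bundles are merely numbered by agents, so
    there is one per agent. *)
Definition packing (w : {set M} -> R) (mu : R) B : Prop :=
  [/\ forall j, independent G (B j), forall j k, j != k -> [disjoint B j & B k] &
      forall j, mu <= w (B j)].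

Lemma packing_mass w mu B (J : {set N}) :
  additive_valuation w -> packing w mu B -> #|J|%:R * mu <= w (\bigcup_(j in J) B j).
Proof.
move=> hw [_ dB leB]; rewrite (val_bigcup hw) // mulr_natl -sumr_const.
by apply: ler_sum => j _.
Qed.

(** The first divider offers its own bundles in [J i], as [alpha <= 1]. Once only [Y] is left, in
    units of [mu i], at most [alpha * (#|X| - #|Y|)] has been lost out of [#|X|], and bag filling
    needs [alpha * (2 * #|Y| - 2 + c)]. The worst case [#|Y| = #|X| - 1] is the hypothesis on
    [alpha]. *)
Lemma small_items_mms (alpha : R) (c : nat) v (mu : N -> R)
    (B : N -> N -> {set M}) (J : N -> {set N}) X U :
    (forall i, additive_valuation (v i)) ->
    (forall i, packing (v i) (mu i) (B i)) ->
    0 < alpha <= 1 -> alpha * (2 * #|X|%:R - 3 + c%:R) <= #|X|%:R -> (0 < c)%N ->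
    {in X, forall i, [/\ #|J i| = #|X|, {in J i, forall j, [disjoint B i j & U]},
        0 < alpha * mu i & {in ~: U, forall g, v i [set g] <= alpha * mu i}]} ->
    {in X, forall i, exists (K : finType) (C : K -> {set M}) (L : {set K}),
        [/\ #|L| = c, {in L, forall k, independent G (C k)} &
            \bigcup_(j in J i) B i j \subset \bigcup_(k in L) C k]} ->
  exists A, serves v (fun i => alpha * mu i) X U A.
Proof.
move=> hv pB /andP[alpha0 alpha1] alphac c0 hJ hC.
have mu0 i : i \in X -> 0 < mu i by move=> /hJ[_ _ + _]; rewrite pmulr_rgt0.
apply: lone_divider => // i Xi.
  have [cardJ dJ _ _] := hJ i Xi; have [indB dB leB] := pB i.
  have [|f injf fJ] := exists_injection i (X := X) (J := J i); first by rewrite cardJ.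
  exists (B i \o f); split=> [j Xj|j k Xj Xk jk] /=.
    split=> //; first exact/dJ/fJ.
    by apply: le_trans (leB _); rewrite ler_piMl // ltW ?mu0.
  by apply: dB; apply: contra_neq jk => /injf; apply.
move=> Y W YX leW.
have [cardJ dJ t0 small] := hJ i Xi; have [K [C [L [cardL indC sC]]]] := hC i Xi.
apply: (bag_filling (v := v i) (C := C) (J := L) (W := \bigcup_(j in J i) B i j)) => //.
- by move=> g; rewrite !inE negb_or => /andP[gU _]; apply: small; rewrite inE.
- by rewrite -card_gt0 cardL.
have mass := packing_mass (J i) (hv i) (pB i); rewrite cardJ in mass.
have dBU : [disjoint \bigcup_(j in J i) B i j & U].
  by rewrite disjoint_sym; apply/bigcup_disjoint => j Jj; rewrite disjoint_sym dJ.
rewrite -setDDl (setDidPl dBU).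
have leD := valD (hv i) (\bigcup_(j in J i) B i j) W.
have ltYX : #|Y|%:R + 1 <= #|X|%:R :> R.
  by rewrite -[1]/(1%:R) -natrD ler_nat addn1; apply: proper_card.
have alphacmu := ler_wpM2r (ltW (mu0 i Xi)) alphac.
by rewrite cardL; nra.
Qed.

(** A set [S] of at most one item meets at most one bundle of each partition, so an agent leaving
    with [S] costs each other agent one bundle. [S] may be empty: agents with a nonpositive
    threshold leave this way, whence [0 < t i] for those that remain. *)
Lemma single_item_reduction v t (B : N -> N -> {set M}) X U (J : N -> {set N}) :
    (forall i, v i set0 = 0) ->
    (forall i j k, j != k -> [disjoint B i j & B i k]) ->
    (forall Y U (J : N -> {set N}), Y \subset X ->
      {in Y, forall i, [/\ #|J i| = #|Y|, {in J i, forall j, [disjoint B i j & U]},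
          0 < t i & {in ~: U, forall g, v i [set g] <= t i}]} ->
      exists A, serves v t Y U A) ->
    {in X, forall i, #|J i| = #|X| /\ {in J i, forall j, [disjoint B i j & U]}} ->
  exists A, serves v t X U A.
Proof.
move=> v0 dB; have [n] := ubnP #|X|.
elim: n X U J => // n IHn X U J ltXn final hJ.
have [/existsP[x /existsP[S /and4P[Xx S1 dSU tS]]]|/existsPn large] :=
  boolP [exists x, exists S : {set M},
    [&& x \in X, (#|S| <= 1)%N, [disjoint S & U] & t x <= v x S]]; last first.
  apply: (final X U J) => // i Xi; have [cardJ dJ] := hJ i Xi.
  have small (S : {set M}) : (#|S| <= 1)%N -> [disjoint S & U] -> v i S < t i.
    by move=> S1 dSU; have /existsPn/(_ S) := large i; rewrite Xi S1 dSU -ltNge.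
  split=> //; first by rewrite -(v0 i) small ?cards0 // disjoints_subset sub0set.
  by move=> g; rewrite inE => gU; rewrite ltW // small ?cards1 ?disjoints1.
(* The bundle to discard: the one hit by [S], or else any member of [J i], so that the count drops
   by exactly one. For [i] in [X] the default is never reached, as [J i] is nonempty. *)
pose k i := if [pick j in J i | ~~ [disjoint B i j & S]] is Some j then j
            else odflt i [pick j in J i].
have cardX := cardsD1 x X; rewrite Xx in cardX.
have [|||A sA] := IHn (X :\ x) (U :|: S) (fun i => J i :\ k i).
- by lia.
- by move=> Y V L sYX; apply: final; apply: subset_trans sYX (subD1set _ _).
- move=> i; rewrite !inE => /andP[_ Xi]; have [cardJ dJ] := hJ i Xi.
  have Jk : k i \in J i.
    rewrite /k; case: pickP => [j /= /andP[]//|_]; case: pickP => //= none.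
    by move: (eq_card0 none); rewrite cardJ; lia.
  split; first by have := cardsD1 (k i) (J i); rewrite Jk cardJ; lia.
  move=> j; rewrite !inE => /andP[jk Jj].
  suff dS : [disjoint B i j & S].
    rewrite disjoint_sym -setI_eq0 setIUl setU_eq0 !setI_eq0.
    by rewrite ![[disjoint _ & B i j]]disjoint_sym dJ.
  move: jk; rewrite /k; case: pickP => [l /= /andP[_ +] jl|/(_ j)]; last first.
    by rewrite /= Jj => /negbFE.
  rewrite -!setI_eq0 => /set0Pn[s]; rewrite inE => /andP[Bs Ss].
  apply/eqP/setP => r; rewrite !inE; apply/negP => /andP[Br Sr].
  have rs := (card_le1_eqP S1) _ _ Sr Ss.
  by have := disjointFr (dB i _ _ jl) Br; rewrite -rs Bs.
exists (fun i => if i \in [set x] then S else A i).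
by apply: serves_add1 => //; apply: independent_le1.
Qed.

(** The number [n] of agents left after the single-item phase is unknown, so [alpha] must be
    admissible for every [n] up to [#|X|], each time with own bundles ([c = n]) or with colour
    classes ([c = col]). *)
Lemma mms_of_counts (alpha : R) v (mu : N -> R) (B : N -> N -> {set M}) X U
    (J : N -> {set N}) (col : nat) :
    (forall i, additive_valuation (v i)) ->
    (forall i, packing (v i) (mu i) (B i)) ->
    0 < alpha <= 1 -> colorable G col ->
    (forall n, (0 < n <= #|X|)%N ->
       alpha * (3 * n%:R - 3) <= n%:R \/
       (0 < col)%N /\ alpha * (2 * n%:R - 3 + col%:R) <= n%:R) ->
    {in X, forall i, #|J i| = #|X| /\ {in J i, forall j, [disjoint B i j & U]}} ->
  exists A, serves v (fun i => alpha * mu i) X U A.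
Proof.
move=> hv pB alpha01 colG bound.
apply: single_item_reduction => [i|i|Y V L sYX hL]; first exact: val0.
  by case: (pB i).
have [->|Y0] := eqVneq Y set0; first by exists (fun=> set0); apply: serves0.
have Yn : (0 < #|Y| <= #|X|)%N by rewrite card_gt0 Y0 subset_leq_card.
have [leN|[col0 leC]] := bound _ Yn.
  apply: small_items_mms (hv) (pB) (alpha01) _ _ (hL) _.
  - by instantiate (1 := #|Y|); lra.
  - by case/andP: Yn.
  - move=> i Yi; have [cardL _ _ _] := hL i Yi; have [indB _ _] := pB i.
    by exists N, (B i), (L i); split=> // k _.
apply: small_items_mms (hv) (pB) (alpha01) (leC) (col0) (hL) _ => i Yi.
have /existsP[c /forallP col_c] := colG.
exists 'I_col, (fun k => [set x | c x == k]), setT; split.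
- by rewrite cardsT card_ord.
- move=> k _; apply/independentP => x y; rewrite !inE => /eqP cx /eqP cy.
  by have /forallP/(_ y)/implyP := col_c x; rewrite cx cy eqxx => Gxy; apply/negP => /Gxy.
- by apply/subsetP => x _; apply/bigcupP; exists (c x); rewrite ?inE.
Qed.

(** * From partial allocations to approximate MMS allocations *)

(** A leftover item that fits nowhere has a neighbour in each of the [#|N|] disjoint bundles, hence
    a degree above [max_degree G]. So leftover items can be added one at a time. *)
Lemma extend_partial v t A :
    (max_degree G < #|N|)%N -> serves v t setT set0 A ->
  exists2 A' : {ffun N -> {set M}}, feasible G A' & forall i, A i \subset A' i.
Proof.
move=> hn [sA dA].
have {sA} : forall i, independent G (A i) by move=> i; have [] := sA i (in_setT i).
have {dA} : forall i j, i != j -> [disjoint A i & A j].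
  by move=> i j; apply: dA; rewrite inE.
have [n] := ubnP #|~: \bigcup_i A i|; elim: n A => // n IHn A ltn dA indA.
have [cover|/set0Pn[x]] := eqVneq (~: \bigcup_i A i) set0.
  exists [ffun i => A i]; last by move=> i; rewrite ffunE.
  apply/andP; split; last by apply/forallP => i; rewrite ffunE.
  apply/andP; split.
    by apply/'forall_forallP => i j; apply/implyP; rewrite !ffunE; apply: dA.
  rewrite (eq_bigr A) => [|i _]; last by rewrite ffunE.
  by rewrite -[X in X == _]setCK cover setC0.
rewrite inE => xA; have xAi i : x \notin A i.
  by apply: contra xA => xAi; apply/bigcupP; exists i.
have [/existsP[i /forall_inP xi]|/existsPn full] :=
  boolP [exists i, [forall y in A i, ~~ G x y]]; last first.
  pose f i := odflt x [pick y in A i | G x y].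
  have fP i : f i \in A i /\ G x (f i).
    rewrite /f; case: pickP => [y /andP[]//|none]; case/negP: (full i).
    by apply/forall_inP => y Ay; have := none y; rewrite /= Ay => /negbT.
  have injf : injective f.
    move=> i j fij; apply/eqP; apply/negPn/negP => /dA dij.
    by have := disjointFr dij (proj1 (fP i)); rewrite fij (proj1 (fP j)).
  have : (#|f @: setT| <= degree G x)%N.
    by apply/subset_leq_card/subsetP => _ /imsetP[i _ ->]; rewrite inE; case: (fP i).
  rewrite card_imset // cardsT => leN.
  by move: hn; rewrite ltnNge (leq_trans leN) // /max_degree leq_bigmax.
pose A2 j := if j == i then x |: A i else A j.
have sA2 j : A j \subset A2 j by rewrite /A2; case: eqP => // ->; apply: subsetUr.
have [|j k jk|j|A' fA' sA'] := IHn A2.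
- rewrite -ltnS; apply: leq_trans ltn; rewrite ltnS; apply: proper_card.
  rewrite properC; apply/properP; split.
    by apply/bigcupsP => j _; apply: (bigcup_max j).
  by exists x => //; apply/bigcupP; exists i; rewrite // /A2 eqxx setU11.
- have cross l : l != i -> [disjoint x |: A i & A l].
    move=> li; rewrite -setI_eq0 setIUl setU_eq0 !setI_eq0 disjoints1 xAi.
    by rewrite dA // eq_sym.
  rewrite /A2; case: eqVneq => [ji|ji]; case: eqVneq => [ki|ki].
  + by rewrite ji ki eqxx in jk.
  + exact: cross.
  + by rewrite disjoint_sym cross.
  + exact: dA.
- rewrite /A2; case: eqP => // _; apply/independentP => y z; rewrite !inE.
  move=> /predU1P[->|Ay] /predU1P[->|Az]; first by rewrite edge_irr.
  + exact: xi.
  + by rewrite edge_sym xi.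
  + by move/independentP: (indA i); apply.
by exists A' => // j; apply: subset_trans (sA' j).
Qed.

Lemma approx_mms_of_serves v (alpha : R) A :
    (forall i, additive_valuation (v i)) -> (max_degree G < #|N|)%N ->
    serves v (fun i => alpha * maximin_share G v i) setT set0 A ->
  exists A' : {ffun N -> {set M}}, approx_mms G v alpha A'.
Proof.
move=> hv hn sA; have [A' fA' sAA'] := extend_partial hn sA.
exists A'; split=> // i; have [_ _] := sA.1 i (in_setT i).
by move=> /le_trans; apply; apply: valS.
Qed.

(** The outer maximum is attained, or is the default 0, which every feasible allocation meets; one
    exists by extending empty bundles. *)
Lemma maximin_share_packing v :
    (forall i, additive_valuation (v i)) -> (max_degree G < #|N|)%N ->
  exists B : N -> {ffun N -> {set M}}, forall i,
    packing (v i) (maximin_share G v i) (B i) /\ \bigcup_j B i j = setT.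
Proof.
move=> hv hn; apply: (fin_all_exists (P := fun i (B : {ffun N -> {set M}}) =>
  packing (v i) (maximin_share G v i) B /\ \bigcup_j B j = setT)) => i.
have exf : exists A : {ffun N -> {set M}}, feasible G A.
  have [|A fA _] := @extend_partial v (fun=> 0) (fun=> set0) hn; last by exists A.
  split=> [j _|j k _ _ _]; last by rewrite disjoints_subset sub0set.
  rewrite independent_le1 ?cards0 // disjoints_subset sub0set; split=> //.
  exact: val_ge0.
suff [B fB leB] : exists2 B : {ffun N -> {set M}}, feasible G B &
    forall j, maximin_share G v i <= v i (B j).
  case/andP: fB => /andP[/'forall_forallP dB /eqP cB] /forallP indB.
  by exists B; split=> //; split=> // j k; apply/implyP/dB.
rewrite /maximin_share; elim/big_ind: _ => [|x y [B fB leB] [C fC leC]|A fA].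
- by case: exf => A fA; exists A => // j; apply: val_ge0.
- by case: (leP x y) => _; [exists C|exists B].
- by exists A => // j; apply: bigmin_le_cond.
Qed.

Lemma mms_of_bound (alpha : R) v :
    (forall i, additive_valuation (v i)) -> (max_degree G < #|N|)%N ->
    0 < alpha <= 1 ->
    (forall n, (0 < n <= #|N|)%N -> alpha * (3 * n%:R - 3) <= n%:R \/
       (0 < chromatic_number G)%N /\
       alpha * (2 * n%:R - 3 + (chromatic_number G)%:R) <= n%:R) ->
  exists A : {ffun N -> {set M}}, approx_mms G v alpha A.
Proof.
move=> hv hn alpha01 bound; have [B hB] := maximin_share_packing hv hn.
have colG : colorable G (chromatic_number G).
  by rewrite /chromatic_number; case: ex_minnP.
have [n|i _|A sA] := mms_of_counts (X := setT) (U := set0) (J := fun=> setT)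
  hv (fun i => proj1 (hB i)) alpha01 colG.
- by rewrite cardsT; apply: bound.
- by split=> // j _; apply: disjoints0r.
exact: approx_mms_of_serves sA.
Qed.

(** * Two and three agents *)

(** Averaging: the bundles of [D] share out all items, which are worth at least [#|N| * mu] because
    of the packing [B]. *)
Lemma packing_favourite (w : {set M} -> R) (mu : R) B (D : N -> {set M}) :
    additive_valuation w -> packing w mu B ->
    \bigcup_j D j = setT -> (forall j k, j != k -> [disjoint D j & D k]) ->
    (0 < #|N|)%N ->
  exists p, mu <= w (D p).
Proof.
move=> hw pB cD dD N0.
have [/existsP//|/existsPn none] := boolP [exists p, mu <= w (D p)].
have mass := packing_mass setT hw pB.
have /le_trans/(_ (valS hw (subsetT _))) := mass; rewrite -cD.
have -> : \bigcup_j D j = \bigcup_(j in setT) D j by apply: eq_bigl => j; rewrite inE.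
rewrite (val_bigcup hw) // leNgt => /negP[]; rewrite mulr_natl -sumr_const.
apply: ltr_sum => [|j _]; last by rewrite ltNge none.
by case/card_gt0P: N0 => i _; apply/hasP; exists i; rewrite ?inE ?mem_index_enum.
Qed.

Lemma mms_two_agents v :
    (forall i, additive_valuation (v i)) -> (max_degree G < #|N|)%N ->
    (#|N| <= 2)%N ->
  exists A : {ffun N -> {set M}}, approx_mms G v 1 A.
Proof.
move=> hv hn le2; have [B hB] := maximin_share_packing hv hn.
have N0 : (0 < #|N|)%N by apply: leq_trans hn.
have [a _] := card_gt0P N0; have [[indB dB leB] cB] := hB a.
have [p hp] : exists p : N -> N, forall b, maximin_share G v b <= v b (B a (p b)).
  apply: (fin_all_exists (P := fun b p => _ <= v b (B a p))) => b.
  exact: packing_favourite (hv b) (proj1 (hB b)) cB dB N0.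
have [b /= ba|noB] := pickP (predC1 a); last first.
  apply: (approx_mms_of_serves (A := B a)) => //.
  split=> [i _|i j _ _]; last exact: dB.
  have /eqP -> := negbFE (noB i); rewrite mul1r; split=> //.
  exact: disjoints0r.
have only i : i != a -> i = b.
  move=> ia; apply/eqP; apply: contraTT le2 => ib.
  have uniq3 : uniq [:: i; a; b] by rewrite /= !inE negb_or ia ib eq_sym ba.
  by rewrite -ltnNge; have := max_card (mem [:: i; a; b]); rewrite (card_uniqP uniq3).
(* The transposition gives [b] its favourite bundle; [a], who cut, accepts whatever it receives. *)
apply: (approx_mms_of_serves (A := fun j => B a (tperm b (p b) j))) => //.
split=> [i _|i j _ _ ij]; last by apply: dB; rewrite (inj_eq perm_inj).
rewrite mul1r; split=> //; first exact: disjoints0r.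
by have [->|/only->] := eqVneq i a; rewrite ?tpermL.
Qed.

Lemma serves_three v t (a b c : N) S (T : {set M}) W :
    uniq [:: a; b; c] -> (forall i, i \in [:: a; b; c]) ->
    [disjoint S & T] -> [disjoint S & W] -> [disjoint T & W] ->
    independent G S -> independent G T -> independent G W ->
    t a <= v a S -> t b <= v b T -> t c <= v c W ->
  exists A, serves v t setT set0 A.
Proof.
rewrite /= !inE negb_or => /and3P[/andP[ab ac] bc _] full dST dSW dTW iS iT iW tS tT tW.
have d0 := @disjoints0r M.
exists (fun i => if i == a then S else if i == b then T else W); split=> [i _|i j _ _].
  have := full i; rewrite !inE => /or3P[]/eqP->; rewrite ?eqxx ?[b == a]eq_sym.
  - by split.
  - by rewrite (negPf ab); split.
  - by rewrite ![c == _]eq_sym (negPf ac) (negPf bc); split.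
have := full i; have := full j; rewrite !inE => /or3P[]/eqP-> /or3P[]/eqP->;
  by rewrite ?eqxx // ?[b == a]eq_sym ?[c == a]eq_sym ?[c == b]eq_sym
     ?(negPf ab) ?(negPf ac) ?(negPf bc) // disjoint_sym.
Qed.

(* Every item of [Q] misses one of the three groups [Y1], [{g}], [Y3] into which
   [P] is cut, since it has at most two neighbours. *)
Lemma split_bundle (w : {set M} -> R) (t : R) (P Q : {set M}) :
    additive_valuation w -> (max_degree G <= 2)%N ->
    independent G P -> independent G Q -> [disjoint P & Q] -> 0 < t ->
    {in P, forall g, w [set g] <= t} -> 2 * t <= w P -> 3 * t <= w P + w Q ->
  exists S T : {set M}, [/\ independent G S, independent G T, [disjoint S & T],
    P \subset S :|: T /\ S :|: T \subset P :|: Q & t <= w S /\ t <= w T].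
Proof.
move=> hw deg2 indP indQ dPQ t0 small geP geQ.
pose far (Y : {set M}) := [set d in Q | [forall y in Y, ~~ G y d]].
(* The two bundles will be [Y :|: far Y] and [P :\: Y]: [far Y] avoids all neighbours of [Y], and
   the bound on [w Y] leaves [t] for the second bundle. *)
suff [Y [sYP leY farY]] : exists Y : {set M},
    [/\ Y \subset P, w Y <= w P - t & t <= w Y + w (far Y)].
  have dYQ : [disjoint Y & far Y].
    apply: disjointWl sYP _; apply: disjointWr dPQ.
    by apply/subsetP => d; rewrite inE => /andP[].
  exists (Y :|: far Y), (P :\: Y); split.
  - apply/independentP => x y; rewrite !inE.
    move=> /orP[Yx|/andP[Qx /forall_inP xY]] /orP[Yy|/andP[Qy /forall_inP yY]].
    + by move/independentP: indP; apply; apply: (subsetP sYP).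
    + exact: yY.
    + by rewrite edge_sym xY.
    + by move/independentP: indQ; apply.
  - exact: independentS (subsetDl _ _) indP.
  - rewrite -setI_eq0; apply/eqP/setP => x; rewrite !inE; apply/negP.
    move=> /andP[/orP[Yx|/andP[Qx _]] /andP[nYx Px]]; first by rewrite Yx in nYx.
    by rewrite (disjointFr dPQ Px) in Qx.
  - split; first by apply/subsetP => x; rewrite !inE => ->; case: (x \in Y) => //=; rewrite orbT.
    apply/subsetP => x; rewrite !inE.
    case/orP=> [/orP[Yx|/andP[Qx _]]|/andP[_ Px]]; last by rewrite Px.
      by rewrite (subsetP sYP).
    by rewrite Qx orbT.
  - by rewrite (valU hw dYQ); split=> //; have := valD hw P Y; lra.
(* [Y1] is a maximal part of [P] that leaves [t] behind, so less than [t] remains in [Y3] once [g]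
   is added. All three groups satisfy [w Y <= w P - t]; for [[set g]] and [Y3] this uses
   [2 * t <= w P]. *)
have [|Y1 /maxsetP[/andP[sY1 leY1] maxY1] _] :=
  @maxset_exists _ [pred Y : {set M} | (Y \subset P) && (w Y <= w P - t)] set0.
  by rewrite /= sub0set (val0 hw); lra.
have [g Pg Y1g] : exists2 g, g \in P & g \notin Y1.
  apply/subsetPn; apply/negP => /(valS hw); lra.
pose Y3 := P :\: (g |: Y1).
have wgY1 : w (g |: Y1) = w [set g] + w Y1 by rewrite (valU hw) // disjoints1.
have sP : w P = w [set g] + w Y1 + w Y3.
  rewrite (valID hw P (g |: Y1)) -wgY1 /Y3; congr (w _ + _).
  by apply/setIidPr; rewrite subUset sub1set Pg.
have big : w P - t < w [set g] + w Y1.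
  rewrite -wgY1 ltNge; apply/negP => le.
  have := maxY1 (g |: Y1); rewrite /= subUset sub1set Pg sY1 le subsetUr.
  by move=> /(_ isT isT) eqY1; rewrite -eqY1 setU11 in Y1g.
have sQ : w Q <= w (far Y1) + w (far [set g]) + w (far Y3).
  suff sQ : Q \subset far Y1 :|: far [set g] :|: far Y3.
    apply: le_trans (valS hw sQ) _; apply: le_trans (valU_le hw _ _) _.
    by rewrite lerD2r valU_le.
  apply/subsetP => d Qd; rewrite !inE Qd /=; apply/negPn/negP.
  rewrite !negb_or -andbA => /and3P[/forall_inPn[y1 Yy1 /negPn e1]].
  move=> /forall_inPn[y2 /set1P-> /negPn e2] /forall_inPn[y3].
  rewrite !inE negb_or => /andP[/andP[y3g y3Y] Py3] /negPn e3.
  have uniq3 : uniq [:: y1; g; y3].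
    rewrite /= !inE negb_or [g == _]eq_sym y3g !andbT; apply/andP; split.
      by apply: contraNneq Y1g => <-.
    by apply: contraNneq y3Y => <-.
  have degd : (degree G d <= 2)%N by apply: leq_trans deg2; apply: leq_bigmax.
  have nbrs : [:: y1; g; y3] \subset [set y | G d y].
    by apply/subsetP => y; rewrite !inE => /or3P[]/eqP->; rewrite edge_sym.
  by have := leq_trans (subset_leq_card nbrs) degd; rewrite (card_uniqP uniq3).
have sg := small g Pg.
(* By [sP] and [sQ] the three sums [w Y + w (far Y)] total at least [w P + w Q], hence [3 * t], so
   one of them reaches [t]. *)
have [l1|l1] := leP t (w Y1 + w (far Y1)); first by exists Y1.
have [l2|l2] := leP t (w [set g] + w (far [set g])).
  by exists [set g]; rewrite sub1set; split=> //; lra.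
by exists Y3; rewrite subsetDl; split=> //; lra.
Qed.

(** If [b] and [c] accept distinct bundles of [B a], then [a] takes the third. Otherwise both accept
    only [B a p]; [b] cuts it in two with the help of [B a r], [c] chooses, and [a] takes
    [B a s]. *)
Lemma three_agents_divide v (mu : N -> R) (B : N -> N -> {set M}) (a b c : N) :
    uniq [:: a; b; c] -> (forall i, i \in [:: a; b; c]) ->
    (forall i, additive_valuation (v i)) -> (max_degree G <= 2)%N ->
    (forall i, packing (v i) (mu i) (B i)) -> \bigcup_j B a j = setT ->
    (forall i, 0 < 2 / 3 * mu i) -> (forall i g, v i [set g] <= 2 / 3 * mu i) ->
  exists A, serves v (fun i => 2 / 3 * mu i) setT set0 A.
Proof.
move=> abc full hv deg2 pB cD t0 small.
have [indD dD leD] := pB a.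
have N3 : #|N| = 3%N.
  by apply: etrans (card_uniqP abc); apply: eq_card => i; rewrite full.
have third (p q : N) : p != q -> exists r, uniq [:: r; p; q] /\ forall i, i \in [:: r; p; q].
  move=> pq; have : [set p; q] \proper [set: N].
    by rewrite properEcard subsetT cards2 pq cardsT N3.
  case/properP => _ [r _]; rewrite !inE negb_or => /andP[rp rq]; exists r.
  have u : uniq [:: r; p; q] by rewrite /= !inE negb_or rp rq pq.
  have cardu : #|[:: r; p; q]| = #|{: N}| by rewrite (card_uniqP u) N3.
  by split=> // i; rewrite (subset_cardP cardu (subset_predT _)).
have mu0 i : 0 < mu i by have := t0 i; lra.
have va p : 2 / 3 * mu a <= v a (B a p) by have := leD p; have := mu0 a; lra.
have favourite i : exists p, 2 / 3 * mu i <= v i (B a p).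
  have [|p le_p] := packing_favourite (hv i) (pB i) cD dD; first by rewrite N3.
  by exists p; have := mu0 i; lra.
have [p bp] := favourite b; have [q cq] := favourite c.
have distinct (p' q' : N) : p' != q' -> 2 / 3 * mu b <= v b (B a p') ->
    2 / 3 * mu c <= v c (B a q') ->
    exists A, serves v (fun i => 2 / 3 * mu i) setT set0 A.
  move=> pq bp' cq'; have [r [+ _]] := third _ _ pq.
  rewrite /= !inE negb_or => /and3P[/andP[rp rq] _ _].
  by apply: (serves_three abc full (S := B a r) (T := B a p') (W := B a q'));
    rewrite ?dD.
have [qp|] := eqVneq p q; last by move/distinct; apply.
rewrite -{}qp in cq.
have [/existsP[p' /andP[p'p bp']]|/existsPn bonly] :=
  boolP [exists p', (p' != p) && (2 / 3 * mu b <= v b (B a p'))].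
  exact: distinct p'p bp' cq.
have [/existsP[q' /andP[q'p cq']]|/existsPn conly] :=
  boolP [exists q', (q' != p) && (2 / 3 * mu c <= v c (B a q'))].
  by apply: distinct bp cq'; rewrite eq_sym.
have [r rp] : exists r, r != p.
  by apply/existsP; apply: contraTT abc => /existsPn all_p;
    rewrite (eqP (negPn (all_p a))) (eqP (negPn (all_p b))) /= inE eqxx.
have [s [srp fullN]] := third r p rp.
have total i : 3 * mu i <= v i (B a s) + v i (B a r) + v i (B a p).
  have := packing_mass setT (hv i) (pB i); rewrite cardsT N3 => /le_trans; apply.
  apply: le_trans (valS (hv i) (subsetT _)) _; rewrite -cD.
  have -> : \bigcup_j B a j = B a s :|: B a r :|: B a p.
    apply/eqP; rewrite eqEsubset !subUset !bigcup_sup // !andbT.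
    apply/bigcupsP => j _; have := fullN j; rewrite !inE.
    by move=> /or3P[]/eqP->; rewrite ?subsetUr // -setUA ?subsetUl // setUCA subsetUl.
  by apply: le_trans (valU_le (hv i) _ _) _; rewrite lerD2r (valU_le (hv i)).
move: srp; rewrite /= !inE negb_or => /and3P[/andP[sr sp] _ _].
have := bonly r; have := bonly s; have := conly r; have := conly s.
rewrite rp sp /= -!ltNge => cs cr bs br.
have tb := total b; have tc := total c; have mub := mu0 b; have muc := mu0 c.
(* For [b], the bundles at [r] and [s] are each below [2/3 mu]. Out of [3 mu], this leaves over
   [5/3 mu] at [p], enough for [2 t = 4/3 mu], and over [7/3 mu] at [p] and [r] together, enough for
   [3 t = 2 mu]. *)
have [||||S [T [indS indT dST [sPST sSTP] [bS bT]]]] :=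
  split_bundle (hv b) deg2 (indD p) (indD r) _ (t0 b).
- by rewrite dD // eq_sym.
- by move=> g _; apply: small.
- lra.
- lra.
have dsST : [disjoint B a s & S :|: T].
  apply: disjointWr sSTP _.
  by rewrite disjoint_sym -setI_eq0 setIUl setU_eq0 !setI_eq0 !dD // eq_sym.
have dsS := disjointWr (subsetUl S T) dsST.
have dsT := disjointWr (subsetUr S T) dsST.
(* [B a p] is worth over [5/3 mu] to [c] too, so [c] accepts [S] or [T], and [b] is content with the
   other. *)
have cST : v c (B a p) <= v c S + v c T.
  exact: le_trans (valS (hv c) sPST) (valU_le (hv c) S T).
have [cS|cS] := leP (2 / 3 * mu c) (v c S).
  apply: (serves_three abc full (S := B a s) (T := T) (W := S)) => //.
  by rewrite disjoint_sym.
apply: (serves_three abc full (S := B a s) (T := S) (W := T)) => //.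
lra.
Qed.

(** If some agent left with a single item, at most two remain and [alpha * (3 n - 3) <= n] holds for
    [alpha = 2/3]. Otherwise one agent divides its full partition. *)
Lemma mms_three_agents v :
    (forall i, additive_valuation (v i)) -> (max_degree G < #|N|)%N ->
    #|N| = 3%N ->
  exists A : {ffun N -> {set M}}, approx_mms G v (2 / 3) A.
Proof.
move=> hv hn N3; have [B hB] := maximin_share_packing hv hn.
have pB i := proj1 (hB i).
have deg2 : (max_degree G <= 2)%N by rewrite -ltnS -N3.
have colG : colorable G (chromatic_number G).
  by rewrite /chromatic_number; case: ex_minnP.
suff [A sA] : exists A, serves v (fun i => 2 / 3 * maximin_share G v i) setT set0 A.
  exact: approx_mms_of_serves sA.
apply: (single_item_reduction (B := B) (J := fun=> setT)) => [i|i|Y U J _ hJ|i _].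
- exact: val0.
- by case: (pB i).
- have [YT|YT] := eqVneq Y setT; last first.
    apply: (mms_of_counts (J := J) hv pB _ colG) => [|n /andP[n0 nY]|i Yi]; first by lra.
      left; have : n%:R <= 2 :> R; last by lra.
      rewrite (ler_nat R n 2) (leq_trans nY) // -ltnS -N3 -cardsT.
      by apply: proper_card; rewrite properT.
    by have [? ? _ _] := hJ i Yi.
  move: hJ; rewrite {}YT => hJ.
  have [a [b [c [abc full]]]] : exists a b c : N,
      uniq [:: a; b; c] /\ forall i, i \in [:: a; b; c].
    have := enum_uniq N; have : size (enum N) = 3%N by rewrite -cardE.
    have full i : i \in enum N by rewrite mem_enum.
    by case: (enum N) full => [|a [|b [|c []]]] // full _ us; exists a, b, c.
  (* All bundles of [a] are intact and they cover [M], so no item has been taken. *)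
  have U0 : U = set0.
    have [cardJ dJ _ _] := hJ a (in_setT a).
    have JT : J a = setT by apply/eqP; rewrite eqEcard subsetT cardJ leqnn.
    apply/setP => g; rewrite inE; apply/negP => Ug.
    have : g \in \bigcup_j B a j by rewrite (proj2 (hB a)) inE.
    case/bigcupP => j _ Bg; have Jj : j \in J a by rewrite JT inE.
    by rewrite (disjointFl (dJ j Jj) Ug) in Bg.
  rewrite U0; apply: (three_agents_divide (B := B) abc full) => // [|i|i g].
  - exact: proj2 (hB a).
  - by have [] := hJ i (in_setT i).
  - by have [_ _ _] := hJ i (in_setT i); apply; rewrite inE U0 inE.
- by split=> // j _; apply: disjoints0r.
Qed.

End Serves.

(** * Choice of the approximation ratios *)

Unset Implicit Arguments.
Set Strict Implicit.
Set Printing Implicit Defensive.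

Theorem theorem1 (R : realFieldType) (N M : finType)
    (v : N -> {set M} -> R) (G : sgraph M)
    (hv : forall i, additive_valuation (v i))
    (hn : (max_degree G < #|N|)%N) :
  (exists alpha : R, 1 / 3 < alpha /\ exists A, approx_mms G v alpha A) /\
  [/\ (#|N| <= 2)%N -> exists A, approx_mms G v 1 A,
      #|N| = 3%N -> exists A, approx_mms G v (2 / 3) A,
      (4 <= #|N|)%N -> chromatic_number G = 2%N ->
        exists A, approx_mms G v (#|N|%:R / (2 * #|N|%:R - 1)) A &
      (4 <= #|N|)%N -> (3 <= chromatic_number G)%N ->
        exists A, approx_mms G v
          ((chromatic_number G)%:R / (3 * (chromatic_number G)%:R - 3)) A].
Proof.
have n1 : 1 <= #|N|%:R :> R by rewrite (ler_nat R 1) (leq_trans _ hn).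
have frac01 (p q : R) : 0 < p <= q -> 0 < p / q <= 1.
  move=> /andP[p0 pq]; have q0 := lt_le_trans p0 pq.
  by rewrite divr_gt0 // ler_pdivrMr ?mul1r.
have frac_le (p q x y : R) : 0 < q -> p * x <= y * q -> p / q * x <= y.
  by move=> q0; rewrite mulrAC ler_pdivrMr.
have le_natR (m k : nat) : (0 < m <= k)%N -> 1 <= (m%:R : R) <= k%:R.
  by rewrite (ler_nat R 1) ler_nat.
split.
  (* A single ratio above [1/3] from own bundles alone. The condition [alpha * (3 m - 3) <= m]
     suggests [n / (3 n - 3)]; the [- 2] also covers [n = 1]. *)
  exists (#|N|%:R / (3 * #|N|%:R - 2)); split.
    by rewrite ltr_pdivlMr; lra.
  apply: (mms_of_bound hv hn) => [|m /le_natR/andP[m1 mn]]; first by apply: frac01; lra.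
  by left; apply: frac_le; lra.
split.
- exact: mms_two_agents.
- exact: mms_three_agents.
(* With two colour classes the condition reads [alpha * (2 m - 1) <= m], tightest at [m = n]. *)
- move=> _ chi2; apply: (mms_of_bound hv hn) => [|m /le_natR/andP[m1 mn]].
    by apply: frac01; lra.
  by right; rewrite chi2; split=> //; apply: frac_le; lra.
move=> _ chi3; have chi3R : 3 <= (chromatic_number G)%:R :> R by rewrite (ler_nat R 3).
apply: (mms_of_bound hv hn) => [|m /le_natR/andP[m1 mn]]; first by apply: frac01; lra.
(* [3 m - 3] and [2 m - 3 + chi] agree at [m = chi], where both conditions give the claimed ratio:
   own bundles serve up to there, colour classes beyond. *)
have [mchi|chim] := leP m%:R ((chromatic_number G)%:R : R).
  by left; apply: frac_le; nra.
right; split; first exact: leq_trans chi3.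
apply: frac_le; first lra.
(* the gap between the two sides is [(m - chi) * (chi - 3)] *)
by nra.
Qed.
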